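(* Let $\alpha>2$ and $0<N_1\le N_2$. Consider the two-player Variable-Rate Random Access Game in which player $i\in\{1,2\}$ chooses $\Lambda_i\in[0,N_i]$ and receives payoff \[ U_i(\Lambda_1,\Lambda_2)=\Lambda_i\int_0^\infty e^{-(\Lambda_1+\Lambda_2)x^{2/\alpha}}\frac{dx}{1+x}. \] Define $\Lambda''(\alpha)$, for $\alpha>4$, as the unique solution $\Lambda''>0$ of \[ \int_0^\infty\frac{1-\Lambda'' x^{2/\alpha}}{1+x}\,e^{-2\Lambda'' x^{2/\alpha}}\,dx=0, \] and set $\Lambda''(\alpha)=+\infty$ for $\alpha\le 4$. Let $\hat\Lambda$ denote the unique solution $\Lambda>0$ of \[ \int_0^\infty\frac{1-\Lambda x^{2/\alpha}}{1+x}\,e^{-(N_1+\Lambda)x^{2/\alpha}}\,dx=0. \] Then the game has a unique Nash equilibrium $(\Lambda_1^*,\Lambda_2^* )$, and: (i) (Full/Full reuse) if $N_1\le\Lambda''(\alpha)$ and $N_2\le\hat\Lambda$, then $(\Lambda_1^*,\Lambda_2^* )=(N_1,N_2)$; (ii) (Full/Partial reuse) if $N_1\le\Lambda''(\alpha)$ and $N_2>\hat\Lambda$, then $\Lambda_1^*=N_1$ and $\Lambda_2^*=\hat\Lambda$; (iii) (Partial/Partial reuse) if $N_1>\Lambda''(\alpha)$, then $(\Lambda_1^*,\Lambda_2^* )=(\Lambda''(\alpha),\Lambda''(\alpha))$.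
   Context: A Nash equilibrium is a pair $(\Lambda_1^*,\Lambda_2^* )\in[0,N_1]\times[0,N_2]$ such that $\Lambda_1^*$ maximizes $U_1(\cdot,\Lambda_2^* )$ over $[0,N_1]$ and $\Lambda_2^*$ maximizes $U_2(\Lambda_1^*,\cdot)$ over $[0,N_2]$. *)

(* Defs.v *)
From HB Require Import structures.
From mathcomp Require Import all_boot all_order all_algebra.
From mathcomp Require Import all_classical all_reals all_analysis.
Set Implicit Arguments. Unset Strict Implicit. Unset Printing Implicit Defensive.
Import Order.TTheory GRing.Theory Num.Theory.
Local Open Scope classical_set_scope.
Local Open Scope ring_scope.

(* The common integral  \int_0^oo e^{-(L1+L2) x^{2/alpha}} dx/(1+x), in \bar R
   (it is +oo when L1 + L2 = 0). *)
Definition vr_integral (R : realType) (alpha L : R) : \bar R :=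
  (\int[@lebesgue_measure R]_(x in `[0%R, +oo[)
     (expR (- (L * x `^ (2 / alpha))) / (1 + x))%:E)%E.

(* Payoffs U_1, U_2 (extended-real valued; 0 * +oo = 0 by MathComp convention). *)
Definition U1 (R : realType) (alpha L1 L2 : R) : \bar R :=
  (L1%:E * vr_integral alpha (L1 + L2))%E.
Definition U2 (R : realType) (alpha L1 L2 : R) : \bar R :=
  (L2%:E * vr_integral alpha (L1 + L2))%E.

Definition nash_eq (R : realType) (alpha N1 N2 L1 L2 : R) : Prop :=
  [/\ 0 <= L1 <= N1, 0 <= L2 <= N2,
      (forall l, 0 <= l <= N1 -> (U1 alpha l L2 <= U1 alpha L1 L2)%E) &
      (forall l, 0 <= l <= N2 -> (U2 alpha L1 l <= U2 alpha L1 L2)%E)].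

Definition foc_integral (R : realType) (alpha L c : R) : \bar R :=
  (\int[@lebesgue_measure R]_(x in `[0%R, +oo[)
     ((1 - L * x `^ (2 / alpha)) / (1 + x) * expR (- (c * x `^ (2 / alpha))))%:E)%E.

Definition is_Lpp (R : realType) (alpha : R) (Lpp : \bar R) : Prop :=
  (alpha <= 4 -> Lpp = +oo%E) /\
  (4 < alpha -> exists l : R, [/\ Lpp = l%:E, 0 < l,
      foc_integral alpha l (2 * l) = 0%E &
      forall l' : R, 0 < l' -> foc_integral alpha l' (2 * l') = 0%E -> l' = l]).

Definition is_Lhat (R : realType) (alpha N1 Lh : R) : Prop :=
  [/\ 0 < Lh, foc_integral alpha Lh (N1 + Lh) = 0%E &
      forall l : R, 0 < l -> foc_integral alpha l (N1 + l) = 0%E -> l = Lh].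

(* Main.v *)
Require Import Defs.
From HB Require Import structures.
From mathcomp Require Import all_boot all_order all_algebra.
From mathcomp Require Import all_classical all_reals all_analysis.
From mathcomp Require Import measurable_realfun.
From mathcomp Require Import ring lra.
Import Order.TTheory GRing.Theory Num.Theory.
Import numFieldNormedType.Exports.
Local Open Scope classical_set_scope.
Local Open Scope ring_scope.
Set Implicit Arguments. Unset Strict Implicit. Unset Printing Implicit Defensive.

(* Write d = 2 / alpha, A(c) for the integral of e^(-c x^d) / (1 + x) and B = - A', so that player
   i earns Li A(c) with c = L1 + L2. Since A is convex, the tangent inequality alone shows that in
   an equilibrium Li = min(Ni, h(c)), where h = A / B. Integration by parts gives
     d c B(c) = \int e^(-c x^d) / (1 + x)^2 dx,
   so d c B(c) / A(c) is the mean of 1 / (1 + x) for the weight e^(-c x^d) / (1 + x); it is less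
   than 1, and increases strictly with c by Chebyshev's correlation inequality. Hence h(c) / c is
   strictly decreasing, and 1 = min(N1 / c, h(c) / c) + min(N2 / c, h(c) / c) has at most one
   solution c: the equilibrium is unique. Conversely c - h(c) is strictly increasing where it is
   positive, so the first-order condition determines the best response to a positive rate. If
   alpha <= 4 then d >= 1/2, hence h(c) > c / 2 and no symmetric interior equilibrium exists. *)

(** * Integrability and strict positivity of integrals over the half-line *)

Section HalfLine.
Variable R : realType.
Notation mu := (@lebesgue_measure R).
Notation D := (`[0%R, +oo[%classic : set R).
Implicit Types (f g : R -> R) (x M d : R).

Lemma continuous_within_inv1D : {within D, continuous (fun x : R => (1 + x)^-1)}.
Proof.
apply/subspace_continuousP => x; rewrite /= in_itv/= andbT => x0.
apply: cvgV; first by rewrite gt_eqF// ltr_wpDr.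
apply: cvgD; first exact: cvg_cst.
by apply: cvg_within_filter; exact: cvg_id.
Qed.

Lemma continuous_within_powR d : 0 < d -> {within D, continuous (fun x : R => x `^ d)}.
Proof.
move=> d0; apply/continuous_within_itvcyP; split.
  move=> x xD; apply: differentiable_continuous.
  exact/derivable1_diffP/(derivable_powR xD).
by rewrite powR0 ?gt_eqF//; exact: powR_cvg0.
Qed.

Lemma integral_invsq : (\int[mu]_(x in D) ((1 + x) ^- 2)%:E = 1)%E.
Proof.
have cf x : 0 <= x -> ((fun y : R => (1 + y) ^- 2) @ x --> (1 + x) ^- 2).
  move=> x0; apply: cvgV; first by rewrite expf_neq0// gt_eqF// ltr_wpDr.
  by apply: cvgM; apply: cvgD => //; exact: cvg_cst.
have cF x : 0 <= x -> ((fun y : R => - (1 + y)^-1) @ x --> - (1 + x)^-1).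
  move=> x0; apply: cvgN; apply: cvgV; first by rewrite gt_eqF// ltr_wpDr.
  by apply: cvgD => //; exact: cvg_cst.
have dF x : 0 < x -> is_derive x 1 (fun y : R => - (1 + y)^-1) ((1 + x) ^- 2).
  move=> x0; have nz : 1 + x != 0 by rewrite gt_eqF// ltr_wpDr// ltW.
  apply: is_derive_eq; rewrite /GRing.scale/=; by field.
rewrite (@ge0_continuous_FTC2y R (fun x => (1 + x) ^- 2) (fun x => - (1 + x)^-1) 0 0).
- by rewrite addr0 invr1 sub0e EFinN oppeK.
- by move=> x x0; rewrite invr_ge0 exprn_ge0// addr_ge0.
- apply/continuous_within_itvcyP; split.
    by move=> x; rewrite in_itv/= andbT => /ltW; exact: cf.
  exact/cvg_at_right_filter/cf.
- rewrite -oppr0; apply: cvgN; apply/gtr0_cvgV0.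
    by near=> x; rewrite ltr_wpDl.
  apply: cvg_addrl; exact: cvg_id.
- by move=> x x0; have [] := dF _ x0.
- exact/cvg_at_right_filter/cF.
- move=> x; rewrite in_itv/= andbT => x0.
  by rewrite derive1E; have [_ ->] := dF _ x0.
Unshelve. all: by end_near.
Qed.

Lemma integrable_dominated f M : {within D, continuous f} ->
  (forall x, 0 <= x -> `|f x| <= M / (1 + x) ^+ 2) -> mu.-integrable D (EFin \o f).
Proof.
move=> cf fM.
have i1 : mu.-integrable D (EFin \o (fun x : R => (1 + x) ^- 2)).
  apply/integrableP; split.
    have -> : (fun x : R => (1 + x) ^- 2) = (fun x => (1 + x)^-1 * (1 + x)^-1).
      by apply/funext => x; rewrite -exprVn expr2.
    apply/measurable_EFinP; apply: subspace_continuous_measurable_fun => //.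
    by move=> x; apply: cvgM; apply: continuous_within_inv1D.
  apply: (@le_lt_trans _ _ 1%E); last exact: ltry.
  rewrite -integral_invsq le_eqVlt; apply/orP; left; apply/eqP.
  apply: eq_integral => /=.
  move=> x; rewrite inE/= in_itv/= andbT => x0.
  by rewrite ger0_norm// invr_ge0 exprn_ge0// addr_ge0.
have i2 : mu.-integrable D (fun x => M%:E * ((1 + x) ^- 2)%:E)%E.
  by apply: integrableZl i1 => //; exact: measurable_itv.
apply: le_integrable i2 => //.
  by apply/measurable_EFinP; apply: subspace_continuous_measurable_fun.
move=> x /=; rewrite in_itv/= andbT => x0; rewrite lee_fin.
by apply: le_trans (fM x x0) _; exact: ler_norm.
Qed.

(** A zero integral would make [f] vanish almost everywhere, but []a, +oo[] has infinite measure.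
    Below, [a] lies at or beyond the only point where the integrand may vanish. *)
Lemma Rintegral_gt0 f (a : R) :
  mu.-integrable D (EFin \o f) -> 0 <= a ->
  (forall x, 0 <= x -> 0 <= f x) -> (forall x, a < x -> 0 < f x) ->
  0 < \int[mu]_(x in D) f x.
Proof.
move=> fi a0 f0 fp.
have f0' x : D x -> 0 <= f x by rewrite /= in_itv/= andbT; exact: f0.
rewrite lt_neqAle Rintegral_ge0// andbT; apply/negP => /eqP/esym fz.
have mf := measurable_int _ fi.
have fE : (\int[mu]_(x in D) (f x)%:E = 0)%E.
  rewrite -[LHS]fineK; last exact: integrable_fin_num.
  by move: fz; rewrite /Rintegral => ->.
have mD : measurable D by exact: measurable_itv.
have [+ _] := @ae_eq_integral_abs _ _ _ mu D mD (EFin \o f) mf.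
have -> : (\int[mu]_(x in D) `|(EFin \o f) x| = 0)%E.
  rewrite -fE; apply: eq_integral => x; rewrite inE => Dx /=.
  by rewrite ger0_norm// f0'.
move=> /(_ erefl)[N [mN N0 sN]].
have : (mu `]a, +oo[ <= mu N)%E.
  apply: le_measure; rewrite ?inE//.
  move=> x /=; rewrite in_itv/= andbT => ax; apply: sN => /=.
  apply/not_implyP; split; first by rewrite in_itv/= andbT (le_trans a0)// ltW.
  by apply/eqP; rewrite eqe gt_eqF// fp.
by rewrite N0 lebesgue_measure_itv/= ltry.
Qed.

Lemma integrable_subZ f g (a : R) :
  mu.-integrable D (EFin \o f) -> mu.-integrable D (EFin \o g) ->
  mu.-integrable D (EFin \o (fun x => f x - a * g x)).
Proof.
move=> fi gi.
have : mu.-integrable D ((EFin \o f) \- (fun x => a%:E * (EFin \o g) x))%E.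
  by apply: integrableB => //; apply: integrableZl.
apply: eq_integrable; first exact: measurable_itv.
by move=> x _ /=; rewrite EFinB EFinM.
Qed.

Lemma Rintegral_subZ f g (a : R) :
  mu.-integrable D (EFin \o f) -> mu.-integrable D (EFin \o g) ->
  \int[mu]_(x in D) (f x - a * g x)
    = \int[mu]_(x in D) f x - a * \int[mu]_(x in D) g x.
Proof.
move=> fi gi; rewrite RintegralB//; first by rewrite RintegralZl.
exact: (@integrableZl _ _ _ mu _ _ a _ gi).
Qed.

End HalfLine.

(** * The integrals A and B: finiteness, convexity and elasticity *)

Section StretchedLaplace.
Variables (R : realType) (d : R).
Hypothesis d0 : 0 < d.
Notation mu := (@lebesgue_measure R).
Notation D := (`[0%R, +oo[%classic : set R).
Implicit Types (c x : R).

Definition sexp c x : R := expR (- (c * x `^ d)).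
(** [lap] is A and [lap_powR] is B; [lap_sqr] is the right-hand side of the integration by parts. *)
Definition lap c := \int[mu]_(x in D) (sexp c x / (1 + x)).
Definition lap_powR c := \int[mu]_(x in D) (x `^ d * sexp c x / (1 + x)).
Definition lap_sqr c := \int[mu]_(x in D) (sexp c x / (1 + x) ^+ 2).

Lemma sexp_gt0 c x : 0 < sexp c x. Proof. exact: expR_gt0. Qed.

Lemma sexpD c c' x : sexp (c + c') x = sexp c x * sexp c' x.
Proof. by rewrite /sexp -expRD mulrDl opprD. Qed.

(** The exponential of [x ^ d] beats every power of [x]. This bound dominates the integrands of A
    and B and kills the boundary term of the integration by parts. *)
Lemma sexp_bound c : 0 < c ->
  exists2 M : R, 0 < M & forall x, 0 <= x -> (1 + x `^ d) * sexp c x <= M / (1 + x).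
Proof.
move=> c0.
have [n nd] : exists n : nat, 1 <= n%:R * d.
  exists (Num.bound d^-1); rewrite -ler_pdivrMr// div1r.
  by rewrite ltW// archi_boundP// invr_ge0 ltW.
(* This [a] gives [a (1 + y) <= 1 + c y / (n + 1) <= e^(c y / (n + 1))], to be raised to the power
   [n + 1]; [n] powers of [1 + y] control [1 + x], the last one is the factor [1 + x ^ d]. *)
pose a := Num.min 1 (c / n.+1%:R).
have a0 : 0 < a by rewrite lt_min ltr01/= divr_gt0.
exists (2 / a ^+ n.+1); first by rewrite divr_gt0// exprn_gt0.
move=> x x0; set y := x `^ d; have y0 : 0 <= y by exact: powR_ge0.
have x1 : 0 < 1 + x by rewrite ltr_wpDr.
rewrite ler_pdivlMr// mulrAC -ler_pdivlMr ?sexp_gt0//.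
rewrite /sexp expRN invrK mulrAC ler_pdivlMr ?exprn_gt0//.
have yn : 1 + x <= 2 * (1 + y) ^+ n.
  have y1n : 1 <= (1 + y) ^+ n by rewrite exprn_ege1// lerDl.
  have [x1'|x1'] := leP x 1; first by lra.
  have : x <= (1 + y) ^+ n.
    apply: (@le_trans _ _ (y ^+ n)); last by rewrite lerXn2r ?nnegrE// ?addr_ge0// lerDr.
    by rewrite /y -powR_mulrn// -powRrM mulrC le1r_powR// ltW.
  lra.
have ey : (a * (1 + y)) ^+ n.+1 <= expR (c * y).
  have -> : c * y = (c / n.+1%:R * y) * n.+1%:R by rewrite mulrAC divfK ?pnatr_eq0.
  rewrite expRM_natr lerXn2r ?nnegrE ?expR_ge0//; first by rewrite mulr_ge0 ?addr_ge0// ltW.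
  apply: le_trans (expR_ge1Dx _).
  rewrite mulrDr mulr1 lerD// ?ler_wpM2r// /a ge_min ?lexx ?orbT//.
apply: (@le_trans _ _ (2 * (a * (1 + y)) ^+ n.+1)); last by rewrite ler_pM2l.
rewrite exprMn [_ ^+ n.+1 * _]mulrC mulrA ler_pM2r ?exprn_gt0//.
by rewrite exprS mulrCA ler_wpM2l// addr_ge0.
Qed.

Lemma continuous_within_sexp c : {within D, continuous (sexp c)}.
Proof.
move=> x; rewrite /sexp; apply: (@cvg_comp _ _ _ (fun x : subspace D => - (c * x `^ d)) expR).
  apply: cvgN; apply: cvgM; first exact: cvg_cst.
  exact: continuous_within_powR.
exact: continuous_expR.
Qed.

Lemma lap_integrable c : 0 < c ->
  mu.-integrable D (EFin \o (fun x => sexp c x / (1 + x))).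
Proof.
move=> c0; have [M M0 HM] := sexp_bound c0.
apply: (integrable_dominated (M := M)).
  move=> x; apply: cvgM; first exact: continuous_within_sexp.
  exact: continuous_within_inv1D.
move=> x x0; have x1 : 0 < 1 + x by rewrite ltr_wpDr.
rewrite ger0_norm; last by rewrite divr_ge0 ?ltW// sexp_gt0.
rewrite expr2 invfM mulrA ler_wpM2r ?invr_ge0 ?(ltW x1)//.
apply: le_trans (HM x x0); rewrite ler_peMl// ?lerDl ?powR_ge0//.
exact/ltW/sexp_gt0.
Qed.

Lemma lap_powR_integrable c : 0 < c ->
  mu.-integrable D (EFin \o (fun x => x `^ d * sexp c x / (1 + x))).
Proof.
move=> c0; have [M M0 HM] := sexp_bound c0.
apply: (integrable_dominated (M := M)).
  move=> x; apply: cvgM; last exact: continuous_within_inv1D.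
  apply: cvgM; last exact: continuous_within_sexp.
  exact: continuous_within_powR.
move=> x x0; have x1 : 0 < 1 + x by rewrite ltr_wpDr.
rewrite ger0_norm; last by rewrite divr_ge0 ?(ltW x1)// mulr_ge0 ?powR_ge0 ?ltW ?sexp_gt0.
rewrite expr2 invfM mulrA ler_wpM2r ?invr_ge0 ?(ltW x1)//.
apply: le_trans (HM x x0); rewrite ler_wpM2r ?lerDr//; exact/ltW/sexp_gt0.
Qed.

Lemma lap_sqr_integrable c : 0 < c ->
  mu.-integrable D (EFin \o (fun x => sexp c x / (1 + x) ^+ 2)).
Proof.
move=> c0; apply: (integrable_dominated (M := 1)).
  have -> : (fun x => sexp c x / (1 + x) ^+ 2) =
    (fun x => sexp c x * ((1 + x)^-1 * (1 + x)^-1)).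
    by apply/funext => x; rewrite -exprVn expr2.
  move=> x; apply: cvgM; first exact: continuous_within_sexp.
  by apply: cvgM; exact: continuous_within_inv1D.
move=> x x0; have x1 : 0 < (1 + x) ^+ 2 by rewrite exprn_gt0// ltr_wpDr.
rewrite ger0_norm; last by rewrite divr_ge0 ?ltW// sexp_gt0.
rewrite ler_wpM2r ?invr_ge0 ?(ltW x1)// /sexp expR_le1 oppr_le0.
by rewrite mulr_ge0 ?powR_ge0 ?ltW.
Qed.

Lemma lap_gt0 c : 0 < c -> 0 < lap c.
Proof.
move=> c0; apply: (Rintegral_gt0 (lap_integrable c0) (lexx 0)) => x x0.
  by rewrite divr_ge0 ?addr_ge0// ltW// sexp_gt0.
by rewrite divr_gt0 ?sexp_gt0// ltr_wpDr// ltW.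
Qed.

Lemma lap_powR_gt0 c : 0 < c -> 0 < lap_powR c.
Proof.
move=> c0; apply: (Rintegral_gt0 (lap_powR_integrable c0) (lexx 0)) => x x0.
  by rewrite divr_ge0 ?addr_ge0// mulr_ge0 ?powR_ge0// ltW// sexp_gt0.
by rewrite divr_gt0 ?mulr_gt0 ?powR_gt0 ?sexp_gt0// ltr_wpDr// ltW.
Qed.

Lemma lap_sqr_gt0 c : 0 < c -> 0 < lap_sqr c.
Proof.
move=> c0; apply: (Rintegral_gt0 (lap_sqr_integrable c0) (lexx 0)) => x x0.
  by rewrite divr_ge0 ?exprn_ge0 ?addr_ge0// ltW// sexp_gt0.
by rewrite divr_gt0 ?sexp_gt0// exprn_gt0// ltr_wpDr// ltW.
Qed.

Lemma lap_sqr_lt c : 0 < c -> lap_sqr c < lap c.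
Proof.
move=> c0; rewrite -subr_gt0 -[lap_sqr c]mul1r.
have h1 := lap_integrable c0; have h2 := lap_sqr_integrable c0.
rewrite -Rintegral_subZ//.
have fE x : 0 <= x -> sexp c x / (1 + x) - 1 * (sexp c x / (1 + x) ^+ 2) =
    sexp c x * x / (1 + x) ^+ 2.
  by move=> x0; field; rewrite gt_eqF// ltr_wpDr.
apply: (Rintegral_gt0 (integrable_subZ 1 h1 h2) (lexx 0)) => x x0.
  by rewrite fE// divr_ge0 ?exprn_ge0 ?addr_ge0// mulr_ge0// ltW// sexp_gt0.
rewrite fE ?(ltW x0)// divr_gt0 ?exprn_gt0 ?mulr_gt0 ?sexp_gt0//.
by rewrite ltr_wpDr// ltW.
Qed.

(** Integrates the pointwise inequality [e^(-t) >= 1 - t] at [t = (c' - c) x ^ d]; it stands in for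
    differentiation under the integral sign. *)
Lemma lap_tangent c c' : 0 < c -> 0 < c' ->
  lap c - (c' - c) * lap_powR c <= lap c'.
Proof.
move=> c0 c'0.
have h1 := lap_integrable c0; have h2 := lap_powR_integrable c0.
rewrite -Rintegral_subZ//.
apply: le_Rintegral; [exact: measurable_itv|exact: integrable_subZ|
  exact: lap_integrable|].
move=> x; rewrite /= in_itv/= andbT => x0.
have x1 : 0 < 1 + x by rewrite ltr_wpDr.
rewrite ler_pdivlMr// mulrBl mulrA !divfK ?gt_eqF//.
have -> : sexp c' x = sexp c x * sexp (c' - c) x by rewrite -sexpD addrC subrK.
have -> : sexp c x - (c' - c) * (x `^ d * sexp c x) =
  sexp c x * (1 - (c' - c) * x `^ d) by ring.
rewrite ler_wpM2l ?(ltW (sexp_gt0 _ _))//.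
exact: expR_ge1Dx.
Qed.

(* [F] is [x * sexp c x / (1 + x)] minus a multiple of [1 / (1 + x)] that makes its derivative [f]
   nonnegative, as the fundamental theorem of calculus on a half-line requires. *)
Lemma lap_by_parts c : 0 < c -> d * (c * lap_powR c) = lap_sqr c.
Proof.
move=> c0; have [M M0 HM] := sexp_bound c0.
have dc0 : 0 < d * c by rewrite mulr_gt0.
pose f0 x := sexp c x / (1 + x) ^+ 2 - d * c * (x `^ d * sexp c x / (1 + x)).
pose f x := f0 x - - (d * c * M) * (1 + x) ^- 2.
pose F x := x * sexp c x / (1 + x) - d * c * M / (1 + x).
have h1 := lap_sqr_integrable c0; have h2 := lap_powR_integrable c0.
have h3 := integrable_subZ (d * c) h1 h2.
have i1 : mu.-integrable D (EFin \o (fun x : R => (1 + x) ^- 2)).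
  apply: (integrable_dominated (M := 1)).
    have -> : (fun x : R => (1 + x) ^- 2) = (fun x => (1 + x)^-1 * (1 + x)^-1).
      by apply/funext => x; rewrite -exprVn expr2.
    by move=> x; apply: cvgM; exact: continuous_within_inv1D.
  by move=> x x0; rewrite ger0_norm ?div1r// invr_ge0 exprn_ge0// addr_ge0.
have F0 : F 0 = - (d * c * M) by rewrite /F mul0r mul0r addr0 invr1 mulr1 sub0r.
have cid : {within D, continuous (fun x : R => x)}.
  by apply/subspace_continuousP => x _; apply: cvg_within_filter; exact: cvg_id.
have cF : {within D, continuous F}.
  move=> x; apply: cvgB.
    apply: cvgM; last exact: continuous_within_inv1D.
    by apply: cvgM; [exact: cid|exact: continuous_within_sexp].
  by apply: cvgM; [exact: cvg_cst|exact: continuous_within_inv1D].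
have cf : {within D, continuous f}.
  have -> : f = (fun x => sexp c x * ((1 + x)^-1 * (1 + x)^-1) -
     d * c * (x `^ d * sexp c x / (1 + x)) -
     - (d * c * M) * ((1 + x)^-1 * (1 + x)^-1)).
    by apply/funext => x; rewrite /f /f0 -exprVn expr2.
  have ci := continuous_within_inv1D (R := R).
  move=> x; apply: cvgB; last first.
    by apply: cvgM; [exact: cvg_cst|apply: cvgM; exact: ci].
  apply: cvgB.
    by apply: cvgM; [exact: continuous_within_sexp|apply: cvgM; exact: ci].
  apply: cvgM; first exact: cvg_cst.
  apply: cvgM; last exact: ci.
  by apply: cvgM; [exact: continuous_within_powR|exact: continuous_within_sexp].
have dF x : 0 < x -> is_derive x 1 F (f x).
  move=> x0; have nz : 1 + x != 0 by rewrite gt_eqF// ltr_wpDr// ltW.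
  have dp := is_derive1_powR d x0.
  have de : is_derive x 1 (sexp c) (- (c * (d * x `^ (d - 1))) * sexp c x).
    rewrite /sexp; apply: is_derive_eq; rewrite /GRing.scale/=; by ring.
  rewrite /F; apply: is_derive_eq; rewrite /GRing.scale/=.
  rewrite /f /f0 -(mulr_powRB1 (ltW x0) d0); by field.
have := @Rintegral_ge0_continuous_FTC2y R f F 0 0.
rewrite F0 opprK add0r => H.
have {}H : \int[mu]_(x in D) f x = d * c * M.
  apply: H.
  (* The negative part of [f0] is absorbed by the added term, since [HM] gives
     [x ^ d * sexp c x <= M / (1 + x)]. *)
  - move=> x x0; have x1 : 0 < 1 + x by rewrite ltr_wpDr.
    rewrite /f /f0 mulNr opprK -addrA addr_ge0//.
      by rewrite divr_ge0 ?exprn_ge0 ?(ltW x1)// ltW// sexp_gt0.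
    have -> : - (d * c * (x `^ d * sexp c x / (1 + x))) + d * c * M * (1 + x) ^- 2
      = d * c / (1 + x) * (M / (1 + x) - x `^ d * sexp c x).
      by field; rewrite gt_eqF.
    rewrite mulr_ge0//; first by rewrite divr_ge0 ?(ltW x1)// ltW.
    rewrite subr_ge0; apply: le_trans (HM x x0).
    rewrite ler_wpM2r ?lerDr//; exact/ltW/sexp_gt0.
  - exact: cf.
  - have inv0 : (1 + x)^-1 @[x --> +oo] --> (0 : R).
      apply/gtr0_cvgV0; first by near=> x; rewrite ltr_wpDl.
      apply: cvg_addrl; exact: cvg_id.
    rewrite [X in _ --> X](_ : 0 = 0 - d * c * M * 0); last by ring.
    apply: cvgB; last by apply: cvgM; [exact: cvg_cst|exact: inv0].
    (* Here [x / (1 + x) <= 1 + x ^ d], so [HM] bounds the boundary term by [M / (1 + x)]. *)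
    apply: (@squeeze_cvgr _ _ _ _ (fun=> 0) (fun x => M * (1 + x)^-1)).
    + near=> x; have x0 : 0 <= x by [].
      have x1 : 0 < 1 + x by rewrite ltr_wpDr.
      apply/andP; split.
        by rewrite divr_ge0 ?(ltW x1)// mulr_ge0// ltW// sexp_gt0.
      apply: le_trans (HM x x0).
      rewrite mulrAC ler_wpM2r ?(ltW (sexp_gt0 _ _))//.
      rewrite ler_pdivrMr//.
      have := powR_ge0 x d; nra.
    + exact: cvg_cst.
    + rewrite [X in _ --> X](_ : 0 = M * 0); last by ring.
      by apply: cvgM; [exact: cvg_cst|exact: inv0].
  - by move=> x x0; have [] := dF _ x0.
  - by move/continuous_within_itvcyP : cF => [_]; rewrite F0.
  - move=> x; rewrite in_itv/= andbT => x0.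
    by rewrite derive1E; have [_ ->] := dF _ x0.
(* The added term integrates to [d * c * M], which cancels the boundary value of [F] at 0. *)
move: H; rewrite Rintegral_subZ// Rintegral_subZ//.
have -> : \int[mu]_(x in D) (1 + x) ^- 2 = 1 by rewrite /Rintegral integral_invsq.
rewrite -/(lap_sqr c) -/(lap_powR c) => H; lra.
Unshelve. all: by end_near.
Qed.

(* Chebyshev's correlation inequality: with [m] the mean of [1 / (1 + x)] for the weight of
   [lap c], and [x0] the point where [1 / (1 + x0) = m], the product
   [(1 / (1 + x) - m) * (sexp (c' - c) x - sexp (c' - c) x0)] is nonnegative. *)
Lemma lap_sqr_ratio_lt c c' : 0 < c -> c < c' ->
  lap_sqr c / lap c < lap_sqr c' / lap c'.
Proof.
move=> c0 cc'; have c'0 := lt_trans c0 cc'.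
set m := lap_sqr c / lap c.
have m0 : 0 < m by rewrite divr_gt0 ?lap_sqr_gt0 ?lap_gt0.
have m1 : m < 1 by rewrite ltr_pdivrMr ?lap_gt0// mul1r lap_sqr_lt.
pose x0 := m^-1 - 1.
have x00 : 0 < x0 by rewrite subr_gt0 invf_gt1.
have mx0 : m = (1 + x0)^-1 by rewrite /x0 addrC subrK invrK.
rewrite ltr_pdivlMr ?lap_gt0// -subr_gt0.
pose q0 := sexp (c' - c) x0.
have h1 := lap_integrable c0; have h2 := lap_sqr_integrable c0.
have h1' := lap_integrable c'0; have h2' := lap_sqr_integrable c'0.
have i := integrable_subZ m h2 h1; have i' := integrable_subZ m h2' h1'.
(* The subtracted term is zero because [m] is the mean at [c]; it centres the second factor at
   [x0]. *)
have -> : lap_sqr c' - m * lap c' =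
  (lap_sqr c' - m * lap c') - q0 * (lap_sqr c - m * lap c).
  by rewrite /m divfK ?gt_eqF ?lap_gt0// subrr mulr0 subr0.
rewrite -!Rintegral_subZ//.
have fE x : 0 <= x -> sexp c' x / (1 + x) ^+ 2 - m * (sexp c' x / (1 + x)) -
    q0 * (sexp c x / (1 + x) ^+ 2 - m * (sexp c x / (1 + x))) =
    sexp c x / (1 + x) * (((1 + x)^-1 - (1 + x0)^-1) * (sexp (c' - c) x - q0)).
  move=> xge0; have nz : 1 + x != 0 by rewrite gt_eqF// ltr_wpDr.
  have nz0 : 1 + x0 != 0 by rewrite gt_eqF// ltr_wpDr// ltW.
  have -> : sexp c' x = sexp c x * sexp (c' - c) x by rewrite -sexpD addrC subrK.
  rewrite mx0; by field; rewrite nz nz0.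
have sexp_lt x y : 0 <= x -> x < y -> sexp (c' - c) y < sexp (c' - c) x.
  move=> x_ge0 xy; rewrite /sexp ltr_expR ltrN2 ltr_pM2l ?subr_gt0//.
  by rewrite gt0_ltr_powR// nnegrE// ltW// (le_lt_trans x_ge0).
have inv_lt x y : 0 <= x -> x < y -> (1 + y)^-1 < (1 + x)^-1.
  move=> x_ge0 xy; have y_gt0 := le_lt_trans x_ge0 xy.
  by rewrite ltf_pV2 ?posrE ?ltrD2l// ltr_wpDr// ltW.
have w0 x : 0 <= x -> 0 < sexp c x / (1 + x).
  by move=> ?; rewrite divr_gt0 ?sexp_gt0// ltr_wpDr.
apply: (Rintegral_gt0 (integrable_subZ q0 i' i) (ltW x00)) => x xx0.
  rewrite fE// mulr_ge0 ?(ltW (w0 _ _))//.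
  (* Both factors decrease in [x] and vanish at [x0], so they have the same sign on either side. *)
  have [xlt|xgt|->] := ltgtP x x0; last by rewrite subrr mul0r.
    by rewrite mulr_ge0// subr_ge0 ltW// ?inv_lt// sexp_lt.
  by rewrite mulr_le0// subr_le0 ltW// ?inv_lt ?sexp_lt// ltW.
have x_ge0 : 0 <= x by rewrite ltW// (lt_trans x00).
rewrite fE// mulr_gt0 ?w0// nmulr_rgt0 subr_lt0 ?inv_lt ?sexp_lt// ltW//.
Qed.

(** Up to sign, [c B(c) / A(c)] is the elasticity of A; by parts it is [1 / d] times the mean of
    [1 / (1 + x)]. *)
Lemma lap_elasticity_lt c c' : 0 < c -> c < c' ->
  c * lap_powR c / lap c < c' * lap_powR c' / lap c'.
Proof.
move=> c0 cc'; have c'0 := lt_trans c0 cc'.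
have := lap_sqr_ratio_lt c0 cc'.
by rewrite -!lap_by_parts// -!(mulrA d) ltr_pM2l.
Qed.

Lemma lap_elasticity_ub c : 0 < c -> d * (c * lap_powR c) < lap c.
Proof. by move=> c0; rewrite lap_by_parts// lap_sqr_lt. Qed.

Lemma foc_integralE (alpha L c : R) : d = 2 / alpha -> 0 < c ->
  foc_integral alpha L c = (lap c - L * lap_powR c)%:E.
Proof.
move=> dE c0.
have h1 := lap_integrable c0; have h2 := lap_powR_integrable c0.
have h3 := integrable_subZ L h1 h2.
rewrite -Rintegral_subZ// /Rintegral fineK; last by apply: (integrable_fin_num _ h3).
apply: eq_integral => x _; congr EFin.
by rewrite -dE /sexp; ring.
Qed.

Lemma vr_integralE (alpha c : R) : d = 2 / alpha -> 0 < c ->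
  vr_integral alpha c = (lap c)%:E.
Proof.
move=> dE c0.
have h1 := lap_integrable c0.
rewrite /lap /Rintegral fineK; last by apply: (integrable_fin_num _ h1).
by apply: eq_integral => x _; rewrite -dE.
Qed.

End StretchedLaplace.

(** * Best responses for the payoff [l A(L + l)], from convexity and monotone elasticity alone *)

Section BestResponse.
Variables (R : realType) (A B : R -> R).
Hypothesis A_gt0 : forall c, 0 < c -> 0 < A c.
Hypothesis B_gt0 : forall c, 0 < c -> 0 < B c.
Hypothesis A_tangent : forall c c', 0 < c -> 0 < c' -> A c - (c' - c) * B c <= A c'.
Hypothesis elasticity_lt :
  forall c c', 0 < c -> c < c' -> c * B c / A c < c' * B c' / A c'.
Implicit Types c L l N : R.

(* [foc N l c] says that [l] is the minimum of [N] and [A c / B c]. *)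
Definition foc N l c := [/\ 0 < l <= N, l * B c <= A c & l < N -> l * B c = A c].

(** The strict decrease of h(c) / c, the reciprocal of the elasticity, with denominators cleared. *)
Lemma ratio_lt c c' : 0 < c -> c < c' -> A c' / B c' * c < A c / B c * c'.
Proof.
move=> c0 cc'; have c'0 := lt_trans c0 cc'.
have := elasticity_lt c0 cc'.
rewrite ltr_pdivrMr ?A_gt0// mulrAC ltr_pdivlMr ?A_gt0// => h.
rewrite mulrAC ltr_pdivrMr ?B_gt0// mulrAC mulrAC -mulrA [A c / B c * _]mulrAC.
rewrite ltr_pdivlMr ?B_gt0//; lra.
Qed.

(* [c - A c / B c] is the opponent's rate when [A c / B c] is an interior best response and [c] is
   the total rate. *)
Lemma gap_lt c c' : 0 < c -> c < c' -> 0 < c - A c / B c ->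
  c - A c / B c < c' - A c' / B c'.
Proof.
move=> c0 cc' g0; have := ratio_lt c0 cc'.
set h := A c / B c in g0 *; set h' := A c' / B c' => r.
(* With [r], [c (c' - h') > c' (c - h) > c (c - h)]; the last step uses [g0]. *)
rewrite -(ltr_pM2l c0); nra.
Qed.

(** Near [c], A lies above its tangent at [c] and below a cone of slope B(c / 2). Continuity serves
    the compactness argument for best responses. *)
Lemma A_continuous c : 0 < c -> {for c, continuous A}.
Proof.
move=> c0; have c20 : 0 < c / 2 by rewrite divr_gt0.
(* Adding the tangent inequalities at [a] and [b] gives [(b - a) (B a - B b) >= 0]. *)
have B_anti a b : 0 < a -> a <= b -> B b <= B a.
  move=> a0 ab; have b0 := lt_le_trans a0 ab.
  move: ab; rewrite le_eqVlt => /predU1P[->//|ab].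
  have := A_tangent a0 b0; have := A_tangent b0 a0; nra.
apply: (@squeeze_cvgr _ _ _ _ (fun y => A c - (y - c) * B c)
  (fun y => A c + `|y - c| * B (c / 2))).
- near=> y; have yc : c / 2 < y by near: y; apply: lt_nbhsr; lra.
  have y0 := lt_trans c20 yc; rewrite A_tangent//=.
  have t := A_tangent y0 c0; have Byc := B_anti _ _ c20 (ltW yc).
  have By := B_gt0 y0; have [h|h] := leP 0 (y - c).
    rewrite ger0_norm//.
    have : 0 <= (y - c) * B (c / 2) by rewrite mulr_ge0// ltW// B_gt0.
    have : 0 <= (y - c) * B y by rewrite mulr_ge0// ltW.
    lra.
  rewrite ltr0_norm//.
  have : 0 <= - (y - c) * (B (c / 2) - B y).
    by rewrite mulr_ge0 ?subr_ge0// oppr_ge0 ltW.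
  lra.
- rewrite [X in _ --> X](_ : A c = A c - (c - c) * B c); last by ring.
  apply: cvgB; first exact: cvg_cst.
  apply: cvgM; last exact: cvg_cst.
  apply: cvgB; [exact: cvg_id|exact: cvg_cst].
- rewrite [X in _ --> X](_ : A c = A c + `|c - c| * B (c / 2)).
    apply: cvgD; first exact: cvg_cst.
    apply: cvgM; last exact: cvg_cst.
    apply: cvg_norm; apply: cvgB; [exact: cvg_id|exact: cvg_cst].
  by rewrite subrr normr0 mul0r addr0.
Unshelve. all: by end_near.
Qed.

(* The tangent inequality replaces the derivative of the payoff:
   [l' A(L + l') - l A(L + l) >= (l' - l) (A(L + l) - l' B(L + l))]. *)
Lemma argmax_foc N L l : 0 <= L -> 0 < l <= N ->
  (forall l', 0 < l' <= N -> l' * A (L + l') <= l * A (L + l)) -> foc N l (L + l).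
Proof.
move=> L0 /andP[l0 lN] lmax; have c0 : 0 < L + l by rewrite ltr_wpDl.
have bc := B_gt0 c0; have ac := A_gt0 c0.
have step l' : 0 < l' <= N -> (l' - l) * (A (L + l) - l' * B (L + l)) <= 0.
  move=> l'N; have := lmax _ l'N; case/andP: l'N => l'0 _.
  have c'0 : 0 < L + l' by rewrite ltr_wpDl.
  have := A_tangent c0 c'0.
  rewrite -(ler_pM2l l'0) => h1 h2; have := le_trans h1 h2; lra.
pose h := A (L + l) / B (L + l).
have hE : A (L + l) = h * B (L + l) by rewrite /h divfK// gt_eqF.
have h0 : 0 < h by rewrite divr_gt0.
rewrite /foc hE l0 lN; rewrite hE in step.
have fE l' : (l' - l) * (h * B (L + l) - l' * B (L + l)) =
  (l' - l) * (h - l') * B (L + l) by ring.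
(* By [step], no point of []0, N]] lies strictly between [l] and [h]. The midpoint excludes [h < l];
   the midpoint capped at [N] excludes [l < h] when [l < N]. *)
have lh : l <= h.
  rewrite leNgt; apply/negP => hl.
  have : 0 < (h + l) / 2 <= N by apply/andP; split; lra.
  move/step; rewrite fE pmulr_lle0//; nra.
split=> //; first by rewrite ler_wpM2r// ltW.
move=> lN'; congr (_ * _); apply/eqP; rewrite eq_le lh/= leNgt; apply/negP => lh'.
pose l' := Num.min N ((l + h) / 2).
have ll' : l < l' by rewrite lt_min lN'/=; lra.
have l'h : l' < h by rewrite gt_min; apply/orP; right; lra.
have : 0 < l' <= N by rewrite (lt_trans l0)//= ge_min lexx.
move/step; rewrite fE pmulr_lle0//; nra.
Qed.

(* A maximizer exists by compactness; it satisfies [foc], whose solution is unique for given [L]. *)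
Lemma foc_argmax N L l l' : 0 < L -> foc N l (L + l) -> 0 <= l' <= N ->
  l' * A (L + l') <= l * A (L + l).
Proof.
move=> L0 [/andP[l0 lN] lA lNA] l'N.
have N0 : 0 <= N by rewrite ltW// (lt_le_trans l0).
have cu : {within `[0, N]%classic, continuous (fun x => x * A (L + x))}.
  apply/subspace_continuousP => x; rewrite /= in_itv/= => /andP[x0 _].
  apply: cvg_within_filter; apply: cvgM; first exact: cvg_id.
  apply: (@cvg_comp _ _ _ (fun y => L + y) A _ (nbhs (L + x))).
    by apply: cvgD; [exact: cvg_cst|exact: cvg_id].
  by apply: A_continuous; rewrite ltr_wpDr.
have [m mN mmax] := EVT_max N0 cu.
rewrite in_itv/= in mN; case/andP: mN => m0 mN.
have {}mmax t : 0 <= t <= N -> t * A (L + t) <= m * A (L + m).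
  by move=> tN; apply: mmax; rewrite in_itv.
have c0 : 0 < L + l by rewrite addr_gt0.
have mgt0 : 0 < m.
  rewrite lt_neqAle m0 andbT; apply/eqP => m0'.
  have : l * A (L + l) <= m * A (L + m) by apply: mmax; rewrite ltW.
  by rewrite -m0' mul0r leNgt mulr_gt0// A_gt0.
have cm0 : 0 < L + m by rewrite addr_gt0.
have [_ mA mNA] : foc N m (L + m).
  apply: argmax_foc; [exact: ltW|by rewrite mgt0|].
  by move=> t /andP[t0 tN]; apply: mmax; rewrite ltW.
have hE c t : 0 < c -> t * B c = A c -> A c / B c = t.
  by move=> c_gt0 <-; rewrite mulfK// gt_eqF// B_gt0.
have hle c t : 0 < c -> t * B c <= A c -> t <= A c / B c.
  by move=> c_gt0; rewrite ler_pdivlMr// B_gt0.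
(* The smaller of [l] and [m] would be below [N], so the gap at its total is exactly [L], while the
   gap at the larger total is at most [L]: this contradicts [gap_lt]. *)
suff -> : l = m by exact: mmax.
have [lm|ml|//] := ltgtP l m.
- have hl := hE _ _ c0 (lNA (lt_le_trans lm mN)).
  have hm := hle _ _ cm0 mA.
  have : L + l - A (L + l) / B (L + l) < L + m - A (L + m) / B (L + m).
    by apply: gap_lt => //; rewrite ?ltrD2l// hl addrK.
  by rewrite hl; lra.
- have hm := hE _ _ cm0 (mNA (lt_le_trans ml lN)).
  have hl := hle _ _ c0 lA.
  have : L + m - A (L + m) / B (L + m) < L + l - A (L + l) / B (L + l).
    by apply: gap_lt => //; rewrite ?ltrD2l// hm addrK.
  by rewrite hm; lra.
Qed.

(** The share l / c equals min(N / c, h(c) / c), and both terms strictly decrease. *)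
Lemma foc_ratio N l l' c c' : 0 < c -> c < c' -> foc N l c -> foc N l' c' ->
  l' * c < l * c'.
Proof.
move=> c0 cc' [/andP[l0 lN] lA lNA] [/andP[l'0 l'N] l'A _].
have c'0 := lt_trans c0 cc'.
move: lN; rewrite le_eqVlt => /predU1P[lN|/lNA lE].
  by rewrite (@le_lt_trans _ _ (l * c))// ?ltr_pM2l// ler_wpM2r ?(ltW c0)// lN.
apply: le_lt_trans (_ : A c' / B c' * c < _).
  by rewrite ler_pM2r// ler_pdivlMr// B_gt0.
by have := ratio_lt c0 cc'; rewrite -lE mulfK ?gt_eqF ?B_gt0.
Qed.

(** The two shares sum to 1, so a larger total, which lowers both, is impossible; for equal totals,
    [foc] fixes each rate as a minimum. *)
Lemma foc_unique N1 N2 l1 l2 m1 m2 :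
  foc N1 l1 (l1 + l2) -> foc N2 l2 (l1 + l2) ->
  foc N1 m1 (m1 + m2) -> foc N2 m2 (m1 + m2) -> l1 = m1 /\ l2 = m2.
Proof.
have lt_false k1 k2 n1 n2 : foc N1 k1 (k1 + k2) -> foc N2 k2 (k1 + k2) ->
    foc N1 n1 (n1 + n2) -> foc N2 n2 (n1 + n2) -> k1 + k2 < n1 + n2 -> False.
  move=> fk1 fk2 fn1 fn2 lt.
  have c0 : 0 < k1 + k2 by case: fk1 fk2 => /andP[? _] _ _ [/andP[? _] _ _]; exact: addr_gt0.
  have := foc_ratio c0 lt fk1 fn1; have := foc_ratio c0 lt fk2 fn2; nra.
have same N k n c : 0 < c -> foc N k c -> foc N n c -> k <= n.
  move=> c0 [/andP[k0 kN] kA kNA] [/andP[n0 nN] nA nNA].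
  move: nN; rewrite le_eqVlt => /predU1P[->//|/nNA nE].
  by rewrite -(ler_pM2r (B_gt0 c0)) nE.
move=> f1 f2 g1 g2.
have c0 : 0 < l1 + l2 by case: f1 f2 => /andP[? _] _ _ [/andP[? _] _ _]; exact: addr_gt0.
have [lt|lt|cE] := ltgtP (l1 + l2) (m1 + m2).
- by case: (lt_false _ _ _ _ f1 f2 g1 g2 lt).
- by case: (lt_false _ _ _ _ g1 g2 f1 f2 lt).
rewrite -cE in g1 g2.
by split; apply/eqP; rewrite eq_le; apply/andP; split; apply: same;
  eassumption.
Qed.

End BestResponse.

(** * Nash equilibria as solutions of the first-order conditions *)

Section Game.
Variables (R : realType) (alpha : R).
Hypothesis alpha_gt2 : 2 < alpha.
Let d := 2 / alpha.
Notation A := (lap d).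
Notation B := (lap_powR d).
Notation foc := (foc A B).

Let alpha0 : 0 < alpha. Proof. exact: lt_trans alpha_gt2. Qed.
Let d0 : 0 < d. Proof. by rewrite divr_gt0. Qed.
Let A_gt0 c : 0 < c -> 0 < A c. Proof. exact: lap_gt0. Qed.
Let B_gt0 c : 0 < c -> 0 < B c. Proof. exact: lap_powR_gt0. Qed.
Let A_tangent c c' : 0 < c -> 0 < c' -> A c - (c' - c) * B c <= A c'.
Proof. exact: lap_tangent. Qed.
Let elasticity_lt c c' : 0 < c -> c < c' -> c * B c / A c < c' * B c' / A c'.
Proof. exact: lap_elasticity_lt. Qed.

(** The last hypothesis excludes total rate 0, where the integral is [+oo]. *)
Lemma payoffE L l : 0 <= L -> 0 <= l -> 0 < L \/ 0 < l ->
  (l%:E * vr_integral alpha (L + l) = (l * A (L + l))%:E)%E.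
Proof.
move=> L0 l0 Ll; rewrite (vr_integralE d0 erefl) ?EFinM//.
by case: Ll => ?; [exact: ltr_pwDl|exact: ltr_wpDl].
Qed.

Lemma nash_foc N1 N2 L1 L2 : 0 < N1 -> 0 < N2 ->
  nash_eq alpha N1 N2 L1 L2 -> foc N1 L1 (L1 + L2) /\ foc N2 L2 (L1 + L2).
Proof.
move=> N10 N20 [/andP[L10 L1N] /andP[L20 L2N] m1 m2].
have foc_of N L l : 0 < N -> 0 <= L -> 0 <= l <= N ->
    (forall t, 0 <= t <= N -> (t%:E * vr_integral alpha (L + t) <=
       l%:E * vr_integral alpha (L + l))%E) -> foc N l (L + l).
  move=> N0 L0 /andP[l0 lN] lmax.
  (* Rate 0 earns 0, even against [L = 0] by the convention [0 * +oo = 0], whereas rate [N] earns a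
     positive amount. *)
  have l_gt0 : 0 < l.
    rewrite lt_neqAle l0 andbT; apply/eqP => l00.
    have /lmax : 0 <= N <= N by rewrite (ltW N0) lexx.
    rewrite -l00 mul0e payoffE ?(ltW N0)//; last by right.
    by rewrite lee_fin leNgt mulr_gt0// A_gt0// ltr_wpDl.
  apply: argmax_foc => //; first by rewrite l_gt0.
  move=> t /andP[t0 tN]; rewrite -lee_fin -!payoffE ?(ltW t0) ?(ltW l_gt0)//;
    try by right.
  by apply: lmax; rewrite ltW.
split.
- rewrite addrC; apply: foc_of => //; first by rewrite L10.
  by move=> t tN; rewrite ![L2 + _]addrC; exact: m1.
- by apply: foc_of => //; rewrite L20.
Qed.

(** [foc] makes both rates positive, so each player faces a positive opponent and [foc_argmax]
    applies. *)
Lemma foc_nash N1 N2 L1 L2 :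
  foc N1 L1 (L1 + L2) -> foc N2 L2 (L1 + L2) -> nash_eq alpha N1 N2 L1 L2.
Proof.
move=> f1 f2; have [/andP[L10 L1N] _ _] := f1; have [/andP[L20 L2N] _ _] := f2.
have argmax_of N L l : 0 < L -> foc N l (L + l) ->
    forall t, 0 <= t <= N -> (t%:E * vr_integral alpha (L + t) <=
       l%:E * vr_integral alpha (L + l))%E.
  move=> L0 fl t tN; have [/andP[l0 _] _ _] := fl; have [t0 _] := andP tN.
  rewrite !payoffE ?(ltW L0) ?(ltW l0)//; try by left.
  by rewrite lee_fin; exact: (foc_argmax A_gt0 B_gt0 A_tangent elasticity_lt L0 fl tN).
split; rewrite ?L1N ?L2N ?andbT ?ltW//.
- rewrite addrC in f1; move=> t tN; rewrite /U1 ![_ + L2]addrC; exact: (argmax_of N1).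
- by move=> t tN; exact: (argmax_of N2).
Qed.

Lemma foc_integral_eq0 l c : 0 < c -> foc_integral alpha l c = 0%E -> l * B c = A c.
Proof. by move=> c0; rewrite (foc_integralE d0 l erefl c0) => -[]; lra. Qed.

(** Since Lh = h(N1 + Lh), this is player 1's first-order condition at the candidate equilibrium
    [(N1, Lh)]. *)
Lemma le_Lhat N1 (Lpp : \bar R) Lh : 0 < N1 -> is_Lpp alpha Lpp ->
  is_Lhat alpha N1 Lh -> (N1%:E <= Lpp)%E -> N1 <= Lh.
Proof.
move=> N10 [Lpp4 Lpp5] [Lh0 Lhfoc _] N1Lpp.
have c0 : 0 < N1 + Lh by rewrite addr_gt0.
have LhE := foc_integral_eq0 c0 Lhfoc; have Bc := B_gt0 c0.
rewrite leNgt; apply/negP => LhN1.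
have [a4|a4] := leP alpha 4.
  (* Here Lh = h(c) > d c >= c / 2 with c = N1 + Lh, contrary to [Lh < N1]. *)
  have dhalf : 2^-1 <= d by rewrite /d ler_pdivlMr//; lra.
  have := lap_elasticity_ub d0 c0; rewrite -/d -LhE mulrA ltr_pM2r//.
  have : 0 <= (d - 2^-1) * (N1 + Lh) by rewrite mulr_ge0 ?subr_ge0// ltW.
  lra.
have [l [lE l0 lfoc _]] := Lpp5 a4; rewrite lE lee_fin in N1Lpp.
have l20 : 0 < 2 * l by rewrite mulr_gt0.
(* As h(2 l) / (2 l) = 1/2, the smaller total c = N1 + Lh has Lh / c > 1/2, again contrary to
   [Lh < N1]. *)
have clt : N1 + Lh < 2 * l by lra.
have := ratio_lt A_gt0 B_gt0 elasticity_lt c0 clt.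
rewrite -LhE -(foc_integral_eq0 l20 lfoc) !mulfK ?gt_eqF ?B_gt0//.
nra.
Qed.

End Game.

(** * The three reuse regimes *)

Theorem theorem6 (R : realType) (alpha N1 N2 : R) (Lpp : \bar R) (Lh : R) :
  2 < alpha -> 0 < N1 -> N1 <= N2 ->
  is_Lpp alpha Lpp -> is_Lhat alpha N1 Lh ->
  (exists L1s L2s : R,
     nash_eq alpha N1 N2 L1s L2s /\
     (forall L1 L2 : R, nash_eq alpha N1 N2 L1 L2 -> L1 = L1s /\ L2 = L2s) /\
     ((N1%:E <= Lpp)%E -> N2 <= Lh -> L1s = N1 /\ L2s = N2) /\
     ((N1%:E <= Lpp)%E -> Lh < N2 -> L1s = N1 /\ L2s = Lh) /\
     ((Lpp < N1%:E)%E -> L1s%:E = Lpp /\ L2s%:E = Lpp)).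
Proof.
move=> alpha2 N10 N12 HLpp HLh.
have N20 : 0 < N2 by exact: lt_le_trans N12.
have d0 : 0 < 2 / alpha by rewrite divr_gt0// (lt_trans _ alpha2).
pose A := lap (2 / alpha); pose B := lap_powR (2 / alpha).
have A0 c : 0 < c -> 0 < A c by exact: lap_gt0.
have B0 c : 0 < c -> 0 < B c by exact: lap_powR_gt0.
have eAB c c' : 0 < c -> c < c' -> c * B c / A c < c' * B c' / A c'.
  exact: lap_elasticity_lt.
(* In each regime it remains to exhibit rates satisfying both first-order conditions. *)
have nash_of L1 L2 : foc A B N1 L1 (L1 + L2) -> foc A B N2 L2 (L1 + L2) ->
    nash_eq alpha N1 N2 L1 L2 /\
    (forall M1 M2, nash_eq alpha N1 N2 M1 M2 -> M1 = L1 /\ M2 = L2).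
  move=> f1 f2; split; first exact: foc_nash.
  move=> M1 M2 /(nash_foc alpha2 N10 N20)[g1 g2].
  exact: (foc_unique A0 B0 eAB g1 g2 f1 f2).
have [Lh0 Lhfoc _] := HLh.
have c0 : 0 < N1 + Lh by rewrite addr_gt0.
have LhE : Lh * B (N1 + Lh) = A (N1 + Lh) by exact: foc_integral_eq0 Lhfoc.
have [N1Lpp|LppN1] := leP N1%:E Lpp.
  have N1Lh := le_Lhat alpha2 N10 HLpp HLh N1Lpp.
  have [N2Lh|LhN2] := leP N2 Lh; last first.
    have [||nash uniq] := nash_of N1 Lh.
    - by split; rewrite ?ltxx// ?N10 ?lexx// -LhE ler_pM2r// B0.
    - by split; [rewrite Lh0 ltW|rewrite LhE|].
    by exists N1, Lh.
  (* If h(N1 + N2) < N2, the gap at [N1 + N2] exceeds [N1], which is the gap at the larger total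
     [N1 + Lh]. *)
  have N2foc : N2 * B (N1 + N2) <= A (N1 + N2).
    move: (N2Lh); rewrite le_eqVlt => /predU1P[->|N2Lt]; first by rewrite LhE.
    have c20 : 0 < N1 + N2 by rewrite addr_gt0.
    rewrite leNgt; apply/negP; rewrite -ltr_pdivrMr ?B0// => h.
    have := gap_lt A0 B0 eAB c20 (_ : N1 + N2 < N1 + Lh).
    rewrite ltrD2l => /(_ N2Lt).
    rewrite -LhE mulfK ?gt_eqF ?B0//; lra.
  have [||nash uniq] := nash_of N1 N2.
  - split; rewrite ?ltxx// ?N10 ?lexx//; apply: le_trans N2foc.
    by rewrite ler_pM2r// B0// addr_gt0.
  - by split; rewrite ?ltxx// N20 lexx.
  by exists N1, N2.
have [Lpp4 Lpp5] := HLpp.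
have [a4|a4] := leP alpha 4; first by move: LppN1; rewrite Lpp4.
have [l [lE l0 lfoc _]] := Lpp5 a4; rewrite lE lte_fin in LppN1 *.
(* The equation defining [Lpp] is the interior first-order condition at total [l + l], shared by
   both players; [l < N1 <= N2] makes [l] admissible. *)
have lB : l * B (l + l) = A (l + l).
  by rewrite -mulr2n -mulr_natl; apply: foc_integral_eq0 => //; rewrite mulr_gt0.
have [||nash uniq] := nash_of l l.
- by split; rewrite ?lB// l0 ltW.
- by split; rewrite ?lB// l0 ltW// (lt_le_trans LppN1).
by exists l, l.
Qed.
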